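(* Let $p$ be a prime with $p\equiv 5\pmod 6$, let $b,c\in\mathbf{F}_p$, and assume that $g(z)=z^3-bz-c$ is irreducible over $\mathbf{F}_p$. Let $$f_1(u,v,w)=v^2w^3+3uvw+u^3-bu-v-c,$$ and let $X_1=\{(u,v,w)\mid f_1(u,v,w)=0\}$ be the affine variety over $\mathbf{F}_p$ in affine $3$-space defined by $f_1$. Then $X_1$ is a rational surface, and $|X_1(\mathbf{F}_p)|=p^2-1$.
   Context: $\mathbf{F}_p$ is the field with $p$ elements. A rational surface is one birational to the affine plane. *)

(* Defs.v *)
From mathcomp Require Import all_boot all_algebra.
From mathcomp Require Export mpoly.

Set Implicit Arguments.
Unset Strict Implicit.
Unset Printing Implicit Defensive.

Import GRing.Theory.
Local Open Scope ring_scope.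

(* A sequence S : seq {mpoly k[n]} stands for the closed subscheme V(S) of
   affine n-space over k, with coordinate ring k[x_0, ..., x_(n-1)] / (S).  All
   notions below are relative to k itself: coefficients are never extended. *)

Definition in_ideal (k : fieldType) (n : nat) (S : seq {mpoly k[n]})
    (q : {mpoly k[n]}) : Prop :=
  exists a : 'I_(size S) -> {mpoly k[n]}, q = \sum_(i < size S) a i * S`_i.

(* The coordinate ring of V(S) is an integral domain. *)
Definition integral_variety (k : fieldType) (n : nat) (S : seq {mpoly k[n]})
    : Prop :=
  ~ in_ideal S 1 /\
  forall q r, in_ideal S (q * r) -> in_ideal S q \/ in_ideal S r.

(* phi represents a k-morphism from V(S) to V(T). *)
Definition is_morphism (k : fieldType) (n m : nat) (S : seq {mpoly k[n]})
    (T : seq {mpoly k[m]}) (phi : m.-tuple {mpoly k[n]}) : Prop :=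
  forall t, t \in T -> in_ideal S (t \mPo phi).

(* Two families of polynomials represent the same morphism on V(S) when they
   agree modulo (S); hence the shape of the two inverse laws. *)
Definition isomorphic (k : fieldType) (n m : nat) (S : seq {mpoly k[n]})
    (T : seq {mpoly k[m]}) : Prop :=
  exists (phi : m.-tuple {mpoly k[n]}) (psi : n.-tuple {mpoly k[m]}),
    [/\ is_morphism S T phi,
        is_morphism T S psi,
        forall i : 'I_n, in_ideal S (tnth psi i \mPo phi - 'X_i)
      & forall j : 'I_m, in_ideal T (tnth phi j \mPo psi - 'X_j)].

(* The open subscheme D(g) = {g <> 0} of V(S), realised as the closed subscheme
   g * x_n = 1 of V(S) x A^1, so that its coordinate ring is the localisation
   of that of V(S) at g. *)
Definition principal_open (k : fieldType) (n : nat) (S : seq {mpoly k[n]})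
    (g : {mpoly k[n]}) : seq {mpoly k[n.+1]} :=
  (mwiden g * 'X_ord_max - 1) :: map (@mwiden n k) S.

(* Integral varieties are birational over k when they have isomorphic nonempty
   open subsets.  On an integral V(S), D(g) is nonempty iff g is not in (S).
   Using principal opens loses no generality: they form a basis of the
   topology, and an isomorphism of opens restricts to one of principal opens. *)
Definition birational (k : fieldType) (n m : nat) (S : seq {mpoly k[n]})
    (T : seq {mpoly k[m]}) : Prop :=
  [/\ integral_variety S,
      integral_variety T
    & exists (g : {mpoly k[n]}) (h : {mpoly k[m]}),
        [/\ ~ in_ideal S g, ~ in_ideal T h
          & isomorphic (principal_open S g) (principal_open T h)]].

Definition affine_space (k : fieldType) (n : nat) : seq {mpoly k[n]} := [::].

Definition rational_surface (k : fieldType) (n : nat) (S : seq {mpoly k[n]})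
    : Prop :=
  birational S (affine_space k 2).

Definition rational_points (k : finFieldType) (n : nat) (S : seq {mpoly k[n]})
    : {set {ffun 'I_n -> k}} :=
  [set x : {ffun 'I_n -> k} | all (fun q : {mpoly k[n]} => q.@[x] == 0) S].

Definition f1 (k : fieldType) (b c : k) : {mpoly k[3]} :=
  let u : {mpoly k[3]} := 'X_(@Ordinal 3 0 isT) in
  let v : {mpoly k[3]} := 'X_(@Ordinal 3 1 isT) in
  let w : {mpoly k[3]} := 'X_(@Ordinal 3 2 isT) in
  v ^+ 2 * w ^+ 3 + 3%:R * u * v * w + u ^+ 3 - b *: u - v - c%:MP.

Definition X1 (k : fieldType) (b c : k) : seq {mpoly k[3]} := [:: f1 b c].

(* Main.v *)
Require Import Defs.
From mathcomp Require Import all_boot all_algebra finfield ring zify.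

(* On the part of the surface where [w <> 0], put [z = u - 1/w] and
   [s = u + v w^2].  With [g(z) = z^3 - b z - c] and [Q = s^2 + s z + z^2 - b],
   the equation becomes [Q + w g(z) = 0], so [w = - Q / g(z)], and [s, z] are
   free parameters.  This gives the birational map to the plane.

   The polynomial is quadratic in [v], and its discriminant has odd degree 3 in
   [w] (leading coefficient [- 4 g(u)]), hence is not a square; so the surface
   is integral.

   Over the finite field with [q] elements, where [g] has no root, there are
   [q] points with [w = 0] (the graph [v = g(u)]), and the points with
   [w <> 0] correspond to the pairs [(s, z)] off the conic
   [s^2 + s z + z^2 = b].  This conic has [q + 1] points, because the form is
   the norm from the quadratic extension generated by the cube roots of 1. *)

Set Implicit Arguments.
Unset Strict Implicit.
Unset Printing Implicit Defensive.

Import GRing.Theory.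
Local Open Scope ring_scope.

(** * The defining forms *)

Section Forms.
Variable A : comNzRingType.
Implicit Types b c s u v w z : A.
(** Over an arbitrary commutative ring, the same identities serve in polynomial rings modulo an
    ideal, in nested polynomial rings and at points of a finite field. *)
Definition surface_form b c u v w :=
  v ^+ 2 * w ^+ 3 + 3%:R * u * v * w + u ^+ 3 - b * u - v - c.
Definition cubic_form b c z := z ^+ 3 - b * z - c.
Definition conic_form b s z := s ^+ 2 + s * z + z ^+ 2 - b.

(* [w ^ 3 * cubic_form b c (u - 1 / w)], cleared of denominators *)
Definition homog_cubic b c u w :=
  (u * w - 1) ^+ 3 - b * w ^+ 2 * (u * w - 1) - c * w ^+ 3.
End Forms.

(** * The birational chart *)

(* [I] is the ideal modulo which the identities hold.  The notation stays the
   same on both sides: [m] is [1 / w], [t] is the inverse of [w * G] and [r] is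
   the inverse of [g * Q]. *)
Section Chart.
Variables (A : comNzRingType) (I : A -> Prop).
Hypotheses (idealD : forall x y, I x -> I y -> I (x + y))
           (idealM : forall a x, I x -> I (a * x)).
Variables b c : A.

Section FromSurface.
Variables u v w t : A.
Let G := homog_cubic b c u w.
Let m := t * G.
Let s := u + v * w ^+ 2.
Let z := u - m.
(** Modulo the ideal, [Q = - w g], [g = G / w ^ 3] and [G = 1 / (w t)], so
    [g Q = - 1 / (t ^ 2 w ^ 7)]. *)
Let r := - (t ^+ 2 * w ^+ 7).
Let g := cubic_form b c z.
Let Q := conic_form b s z.
(** [1 / w] as recovered from the plane coordinates, to be compared with [m]. *)
Let M := - (g ^+ 2 * r).
Hypotheses (If : I (surface_form b c u v w)) (It : I (w * G * t - 1)).

Let In : I (m * w - 1).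
Proof. by have -> : m * w - 1 = w * G * t - 1 by rewrite /m; ring. Qed.

Let IG : I (w ^+ 3 * g - G).
Proof.
have -> : w ^+ 3 * g - G = (b * w ^+ 2 - ((u * w - m * w) ^+ 2
    + (u * w - m * w) * (u * w - 1) + (u * w - 1) ^+ 2)) * (m * w - 1).
  by rewrite /g /z /G /cubic_form /homog_cubic; ring.
exact: idealM.
Qed.

Let IQ : I (Q + w * g).
Proof.
have -> : Q + w * g = w * surface_form b c u v w
    + (3%:R * u * m - 3%:R * u ^+ 2 - m ^+ 2 + b - v * w) * (m * w - 1).
  by rewrite /Q /g /z /s /cubic_form /conic_form /surface_form; ring.
by apply: idealD; apply: idealM.
Qed.

Let IM : I (M - m).
Proof.
have -> : M - m = (w ^+ 3 * g + G) * t ^+ 2 * w * (w ^+ 3 * g - G)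
                  + m * (m * w - 1) by rewrite /M /r /m; ring.
by apply: idealD; apply: idealM.
Qed.

Lemma surface_chart_den : I (g * Q * r - 1).
Proof.
have -> : g * Q * r - 1 = - (g * t ^+ 2 * w ^+ 7) * (Q + w * g)
   + ((w ^+ 3 * g + G) * t ^+ 2 * w ^+ 2 * (w ^+ 3 * g - G)
   + (m * w + 1) * (m * w - 1)) by rewrite /r /m; ring.
by do !apply: idealD; apply: idealM.
Qed.

Lemma surface_chart_u : I (z + M - u).
Proof. by have -> : z + M - u = M - m by rewrite /z; ring. Qed.

Lemma surface_chart_v : I (M ^+ 2 * (s - (z + M)) - v).
Proof.
have -> : M ^+ 2 * (s - (z + M)) - v =
   ((M + m) * (s - z) - (M ^+ 2 + M * m + m ^+ 2)) * (M - m)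
   + v * (m * w + 1) * (m * w - 1) by rewrite /z /s; ring.
by do !apply: idealD; apply: idealM.
Qed.

Lemma surface_chart_w : I (- (Q ^+ 2 * r) - w).
Proof.
have -> : - (Q ^+ 2 * r) - w = (Q - w * g) * t ^+ 2 * w ^+ 7 * (Q + w * g)
   + (w ^+ 2 * (M - m) + w * (m * w - 1)) by rewrite /M /r; ring.
by do !apply: idealD; apply: idealM.
Qed.

(** Here [t = 1 / (w G) = 1 / (w ^ 4 g)], where [M] stands for [1 / w] and [Q r] for [1 / g]. *)
Lemma surface_chart_t : I (M ^+ 4 * Q * r - t).
Proof.
have -> : M ^+ 4 * Q * r - t = - (M ^+ 4 * t ^+ 2 * w ^+ 7) * (Q + w * g)
   + (M ^+ 4 * t ^+ 2 * w ^+ 5 * (w ^+ 3 * g - G)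
   + ((M + m) * (M ^+ 2 + m ^+ 2) * t * w ^+ 5 * m * (M - m)
   + t * ((m * w) ^+ 4 + (m * w) ^+ 3 + (m * w) ^+ 2 + m * w + 1)
     * (m * w - 1))).
  (* The identity holds for arbitrary [M], [Q] and [g]; as atoms they are not expanded by [ring]. *)
  rewrite /r; move: (M) (Q) (g) => M' Q' g'; rewrite /m; ring.
by do !apply: idealD; apply: idealM.
Qed.

End FromSurface.

Section FromPlane.
Variables s z r : A.
Let g := cubic_form b c z.
Let Q := conic_form b s z.
(** As [r = 1 / (g Q)], the quotients [g / Q] and [Q / g] become the polynomials [g ^ 2 r] and
    [Q ^ 2 r]. *)
Let m := - (g ^+ 2 * r).
Let u := z + m.
Let v := m ^+ 2 * (s - u).
Let w := - (Q ^+ 2 * r).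
Let t := m ^+ 4 * Q * r.
Let G := homog_cubic b c u w.
Let e := g * Q * r - 1.
Hypothesis Ie : I e.

Let In : I (m * w - 1).
Proof.
have -> : m * w - 1 = (g * Q * r + 1) * e by rewrite /e /m /w; ring.
exact: idealM.
Qed.

Let IG : I (G - w ^+ 3 * g).
Proof.
have -> : G - w ^+ 3 * g = ((z * w) ^+ 2 + z * w * (u * w - 1)
   + (u * w - 1) ^+ 2 - b * w ^+ 2) * (m * w - 1).
  by rewrite /G /g /u /homog_cubic /cubic_form; ring.
exact: idealM.
Qed.

Let IM : I (t * G - m).
Proof.
have -> : t * G - m = m ^+ 4 * Q * r * (G - w ^+ 3 * g)
   + (m * (m * w) ^+ 3 * e
   + m * ((m * w) ^+ 2 + m * w + 1) * (m * w - 1)) by rewrite /e /t; ring.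
by do !apply: idealD; apply: idealM.
Qed.

Let IQ : I (Q + w * g).
Proof.
have -> : Q + w * g = - Q * e by rewrite /e /w; ring.
exact: idealM.
Qed.

Lemma plane_chart_surface : I (surface_form b c u v w).
Proof.
have -> : surface_form b c u v w = m * (Q + w * g)
   + (m * (s - u) ^+ 2 * ((m * w) ^+ 2 + m * w + 1)
      + 3%:R * u * m * (s - u) - g) * (m * w - 1).
  move: (w) => w'.
  rewrite /v /u /g /Q /surface_form /cubic_form /conic_form.
  by move: (m) => m'; ring.
by apply: idealD; apply: idealM.
Qed.

Lemma plane_chart_den : I (w * G * t - 1).
Proof.
have -> : w * G * t - 1 = w * (t * G - m) + (m * w - 1) by ring.
by apply: idealD => //; apply: idealM.
Qed.

Lemma plane_chart_z : I (u - t * G - z).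
Proof.
have -> : u - t * G - z = -1 * (t * G - m) by rewrite /u; ring.
exact: idealM.
Qed.

Lemma plane_chart_s : I (u + v * w ^+ 2 - s).
Proof.
have -> : u + v * w ^+ 2 - s = (s - u) * (m * w + 1) * (m * w - 1).
  by rewrite /v; ring.
exact: idealM.
Qed.

(** The left term is [r (g Q r) ^ 2 (m w) ^ 7], and both [g Q r] and [m w] are 1 modulo the ideal;
    the cofactors are geometric sums. *)
Lemma plane_chart_r : I (- (t ^+ 2 * w ^+ 7) - r).
Proof.
have -> : - (t ^+ 2 * w ^+ 7) - r =
   r * (g * Q * r) ^+ 2 * ((m * w) ^+ 6 + (m * w) ^+ 5 + (m * w) ^+ 4
     + (m * w) ^+ 3 + (m * w) ^+ 2 + m * w + 1) * (m * w - 1)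
   + r * (g * Q * r + 1) * e.
  have -> : - (t ^+ 2 * w ^+ 7) = r * (g * Q * r) ^+ 2 * (m * w) ^+ 7.
    transitivity (- (m * w) ^+ 7 * (Q * r) ^+ 2 * m); first by rewrite /t; ring.
    by rewrite {2}/m; ring.
  by rewrite /e; ring.
by do !apply: idealD; apply: idealM.
Qed.

End FromPlane.
End Chart.

(** * Membership in polynomial ideals *)

Lemma in_idealD (k : fieldType) n (S : seq {mpoly k[n]}) (x y : {mpoly k[n]}) :
  in_ideal S x -> in_ideal S y -> in_ideal S (x + y).
Proof.
move=> [a ->] [a' ->]; exists (fun i => a i + a' i).
by rewrite -big_split; apply: eq_bigr => i _; rewrite mulrDl.
Qed.

Lemma in_idealM (k : fieldType) n (S : seq {mpoly k[n]}) (a x : {mpoly k[n]}) :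
  in_ideal S x -> in_ideal S (a * x).
Proof.
move=> [a' ->]; exists (fun i => a * a' i).
by rewrite mulr_sumr; apply: eq_bigr => i _; rewrite mulrA.
Qed.

Lemma in_ideal_mem (k : fieldType) n (S : seq {mpoly k[n]}) (x : {mpoly k[n]}) :
  x \in S -> in_ideal S x.
Proof.
move=> Sx; have ltx := Sx; rewrite -index_mem in ltx.
exists (fun i => (i == Ordinal ltx)%:R).
rewrite (bigD1 (Ordinal ltx)) //= eqxx mul1r nth_index // big1 ?addr0 // => i.
by move/negPf->; rewrite mul0r.
Qed.

Lemma in_ideal_seq1 (k : fieldType) n (f x : {mpoly k[n]}) :
  in_ideal [:: f] x <-> exists a, x = a * f.
Proof.
split=> [[a ->]|[a ->]]; first by exists (a ord0); rewrite big_ord1.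
by apply: in_idealM; apply: in_ideal_mem; rewrite inE.
Qed.

Lemma in_ideal_nil (k : fieldType) n (x : {mpoly k[n]}) :
  in_ideal [::] x <-> x = 0.
Proof.
by split=> [[a ->]|->]; [rewrite big_ord0 | exists (fun=> 0); rewrite big_ord0].
Qed.

Local Notation var n i := ('X_(@Ordinal n i isT)).

(** * The forms under ring morphisms *)

Section FormsMorphism.
Variables (A B : comNzRingType) (f : {rmorphism A -> B}) (b c s u v w z : A).

Lemma rmorph_surface_form :
  f (surface_form b c u v w) = surface_form (f b) (f c) (f u) (f v) (f w).
Proof. by rewrite /surface_form !(rmorphD, rmorphN, rmorphM, rmorphXn, rmorph_nat). Qed.

Lemma rmorph_cubic_form : f (cubic_form b c z) = cubic_form (f b) (f c) (f z).
Proof. by rewrite /cubic_form !(rmorphD, rmorphN, rmorphM, rmorphXn). Qed.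

Lemma rmorph_conic_form : f (conic_form b s z) = conic_form (f b) (f s) (f z).
Proof. by rewrite /conic_form !(rmorphD, rmorphN, rmorphM, rmorphXn). Qed.

Lemma rmorph_homog_cubic :
  f (homog_cubic b c u w) = homog_cubic (f b) (f c) (f u) (f w).
Proof. by rewrite /homog_cubic !(rmorphD, rmorphN, rmorphM, rmorphXn, rmorph1). Qed.

End FormsMorphism.

Lemma mwidenXU (k : nzRingType) n (i : 'I_n) :
  mwiden ('X_i : {mpoly k[n]}) = 'X_(widen_ord (leqnSn n) i).
Proof. by rewrite mwidenX mnmwiden1. Qed.

(** Since [homog_cubic] is [w ^ 3 g(z)], this is the locus where [w] and [g(z)] are invertible.
    There [Q = - w g(z)] is invertible too, which matches the locus [g Q <> 0] of the plane. *)
Definition surface_open (k : fieldType) (b c : k) : {mpoly k[3]} :=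
  var 3 2 * homog_cubic b%:MP c%:MP (var 3 0) (var 3 2).

Definition plane_open (k : fieldType) (b c : k) : {mpoly k[2]} :=
  cubic_form b%:MP c%:MP (var 2 1) * conic_form b%:MP (var 2 0) (var 2 1).

(** * Isomorphism of the two principal opens *)

Section Iso.
Variables (k : fieldType) (b c : k).

Lemma f1E : f1 b c =
  surface_form b%:MP c%:MP (var 3 0) (var 3 1) (var 3 2).
Proof. by rewrite /f1 /surface_form mul_mpolyC. Qed.

Lemma surface_openE : principal_open (X1 b c) (surface_open b c) =
  [:: var 4 2 * homog_cubic b%:MP c%:MP (var 4 0) (var 4 2) * var 4 3 - 1;
      surface_form b%:MP c%:MP (var 4 0) (var 4 1) (var 4 2)].
Proof.
rewrite /principal_open /X1 /= f1E rmorphM rmorph_homog_cubic rmorph_surface_form.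
rewrite /= !mwidenC !mwidenXU.
by do ![congr (_ :: _) | congr (_ * _ - _) | congr (_ * _)
  | congr homog_cubic | congr surface_form | congr 'X_(_) | exact: val_inj].
Qed.

Lemma plane_openE : principal_open (affine_space k 2) (plane_open b c) =
  [:: cubic_form b%:MP c%:MP (var 3 1) * conic_form b%:MP (var 3 0) (var 3 1)
      * var 3 2 - 1].
Proof.
rewrite /principal_open /= rmorphM rmorph_cubic_form rmorph_conic_form.
rewrite /= !mwidenC !mwidenXU.
by do ![congr (_ :: _) | congr (_ * _ - _) | congr (_ * _)
  | congr cubic_form | congr conic_form | congr 'X_(_) | exact: val_inj].
Qed.

Lemma surface_isomorphic_plane :
  isomorphic (principal_open (X1 b c) (surface_open b c))
             (principal_open (affine_space k 2) (plane_open b c)).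
Proof.
rewrite surface_openE plane_openE; set S := [:: _; _]; set T := [:: _].
pose B n : {mpoly k[n]} := b%:MP; pose C n : {mpoly k[n]} := c%:MP.
pose u : {mpoly k[4]} := var 4 0; pose v : {mpoly k[4]} := var 4 1.
pose w : {mpoly k[4]} := var 4 2; pose t : {mpoly k[4]} := var 4 3.
pose s : {mpoly k[3]} := var 3 0; pose z : {mpoly k[3]} := var 3 1.
pose r : {mpoly k[3]} := var 3 2.
(* The coordinate changes of the chart; the extra coordinates [t] and [r] are the inverses of the
   two denominators. *)
pose s' := u + v * w ^+ 2; pose z' := u - t * homog_cubic (B 4) (C 4) u w.
pose r' := - (t ^+ 2 * w ^+ 7).
pose m' := - (cubic_form (B 3) (C 3) z ^+ 2 * r).
pose u' := z + m'; pose v' := m' ^+ 2 * (s - u').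
pose w' := - (conic_form (B 3) s z ^+ 2 * r).
pose t' := m' ^+ 4 * conic_form (B 3) s z * r.
pose phi : 3.-tuple {mpoly k[4]} := [tuple s'; z'; r'].
pose psi : 4.-tuple {mpoly k[3]} := [tuple u'; v'; w'; t'].
have St : in_ideal S (w * homog_cubic (B 4) (C 4) u w * t - 1).
  by apply: in_ideal_mem; rewrite inE eqxx.
have Sf : in_ideal S (surface_form (B 4) (C 4) u v w).
  by apply: in_ideal_mem; rewrite !inE eqxx orbT.
have Te : in_ideal T (cubic_form (B 3) (C 3) z * conic_form (B 3) s z * r - 1).
  by apply: in_ideal_mem; rewrite inE eqxx.
have phiE : (s \mPo phi = s') * (z \mPo phi = z') * (r \mPo phi = r').
  by rewrite !comp_mpolyXU.
have psiE : (u \mPo psi = u') * (v \mPo psi = v') * (w \mPo psi = w')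
    * (t \mPo psi = t').
  by rewrite !comp_mpolyXU.
have r'E := surface_chart_den (@in_idealD _ _ S) (@in_idealM _ _ S) Sf St.
exists phi, psi; split.
- move=> x; rewrite inE => /eqP ->.
  rewrite rmorphB rmorph1 2!rmorphM rmorph_cubic_form rmorph_conic_form.
  by rewrite /= !comp_mpolyC !phiE.
- move=> x; rewrite !inE => /orP[] /eqP ->.
    rewrite rmorphB rmorph1 2!rmorphM rmorph_homog_cubic /= !comp_mpolyC !psiE.
    exact: (plane_chart_den (@in_idealD _ _ T) (@in_idealM _ _ T) Te).
  rewrite rmorph_surface_form /= !comp_mpolyC !psiE.
  exact: (plane_chart_surface (@in_idealD _ _ T) (@in_idealM _ _ T) Te).
- have m'E : m' \mPo phi = - (cubic_form (B 4) (C 4) z' ^+ 2 * r').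
    rewrite rmorphN rmorphM rmorphXn rmorph_cubic_form /= !comp_mpolyC.
    by rewrite !phiE.
  have QE : conic_form (B 3) s z \mPo phi = conic_form (B 4) s' z'.
    by rewrite rmorph_conic_form /= comp_mpolyC !phiE.
  have u'E : u' \mPo phi = z' + (m' \mPo phi) by rewrite rmorphD /= phiE.
  case=> [[|[|[|[|//]]]] lti]; rewrite (tnth_nth 0) /=.
  + rewrite u'E m'E.
    rewrite (_ : 'X_(Ordinal lti) = u); last by congr 'X_(_); exact: val_inj.
    exact: (surface_chart_u (@in_idealD _ _ S) (@in_idealM _ _ S)).
  + rewrite rmorphM rmorphXn rmorphB /= u'E m'E phiE.
    rewrite (_ : 'X_(Ordinal lti) = v); last by congr 'X_(_); exact: val_inj.
    exact: (surface_chart_v (@in_idealD _ _ S) (@in_idealM _ _ S)).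
  + rewrite rmorphN rmorphM rmorphXn /= QE phiE.
    rewrite (_ : 'X_(Ordinal lti) = w); last by congr 'X_(_); exact: val_inj.
    exact: (surface_chart_w (@in_idealD _ _ S) (@in_idealM _ _ S)).
  + rewrite 2!rmorphM rmorphXn /= m'E QE phiE.
    rewrite (_ : 'X_(Ordinal lti) = t); last by congr 'X_(_); exact: val_inj.
    exact: (surface_chart_t (@in_idealD _ _ S) (@in_idealM _ _ S)).
- case=> [[|[|[|//]]] lti]; rewrite (tnth_nth 0) /=.
  + rewrite rmorphD rmorphM rmorphXn /= !psiE.
    rewrite (_ : 'X_(Ordinal lti) = s); last by congr 'X_(_); exact: val_inj.
    exact: (plane_chart_s (@in_idealM _ _ T) Te).
  + rewrite rmorphB rmorphM rmorph_homog_cubic /= !comp_mpolyC !psiE.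
    rewrite (_ : 'X_(Ordinal lti) = z); last by congr 'X_(_); exact: val_inj.
    exact: (plane_chart_z (@in_idealD _ _ T) (@in_idealM _ _ T) Te).
  + rewrite rmorphN rmorphM !rmorphXn /= !psiE.
    rewrite (_ : 'X_(Ordinal lti) = r); last by congr 'X_(_); exact: val_inj.
    exact: (plane_chart_r (@in_idealD _ _ T) (@in_idealM _ _ T) Te).
Qed.
End Iso.

(** * Integrality *)

(* A product of two remainders modulo [f], of degree at most 1 each, that is
   divisible by [f] equals [l * f] for a constant [l]; then [l ^ 2] times the
   discriminant of [f] is a square. *)
Section QuadraticPrime.
Import Pdiv.Idomain.
Variables (A : idomainType) (f : {poly A}).
Hypothesis size_f : size f = 3%N.
Hypothesis lead_f_regular :
  forall p h, f`_2 *: p = h * f -> exists h', p = h' * f.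
Hypothesis disc_f_nonsquare : forall x y,
  x ^+ 2 = (f`_1 ^+ 2 - 4%:R * f`_2 * f`_0) * y ^+ 2 -> y = 0.

Let lead_fX_regular n p h : f`_2 ^+ n *: p = h * f -> exists h', p = h' * f.
Proof.
elim: n h => [|n IHn] h; first by rewrite scale1r; exists h.
by rewrite exprS -scalerA => /lead_f_regular[h' /IHn].
Qed.

Lemma quadratic_prime p q h : p * q = h * f ->
  (exists h', p = h' * f) \/ (exists h', q = h' * f).
Proof.
move=> pqE.
have lead_f : lead_coef f = f`_2 by rewrite lead_coefE size_f.
have divE r : f`_2 ^+ scalp r f *: r = r %/ f * f + r %% f.
  by rewrite -lead_f divp_eq.
(* In a domain one remainder then vanishes, so [f] divides [p] or [q] up to a power of its leading
   coefficient, which [lead_fX_regular] removes. *)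
suff: (p %% f) * (q %% f) = 0.
  move/eqP; rewrite mulf_eq0 => /orP[] /eqP r0; [left|right].
    by apply: (lead_fX_regular (n := scalp p f) (h := p %/ f)); rewrite divE r0 addr0.
  by apply: (lead_fX_regular (n := scalp q f) (h := q %/ f)); rewrite divE r0 addr0.
have small r : (size (r %% f)%R <= 2)%N.
  by rewrite -ltnS -size_f ltn_modp -size_poly_eq0 size_f.
have [H HE] : exists H, (p %% f) * (q %% f) = H * f.
  pose a := f`_2 ^+ scalp p f; pose d := f`_2 ^+ scalp q f.
  have pE : p %% f = a *: p - p %/ f * f by rewrite divE addrC addKr.
  have qE : q %% f = d *: q - q %/ f * f by rewrite divE addrC addKr.
  exists ((a * d) *: h - (a *: p) * (q %/ f) - (p %/ f) * (q %% f)).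
  rewrite 2!mulrBl -scalerAl -pqE {1}pE {1}qE mulrBl mulrBr.
  rewrite -!scalerAl -!scalerAr !scalerA !mulrA {1}qE mulrBr -!mul_polyC !polyCM.
  by ring.
rewrite HE; suff -> : H = 0 by rewrite mul0r.
apply/eqP; apply: contraT => H0.
have sizeH : (size H <= 1)%N.
  have f0 : f != 0 by rewrite -size_poly_eq0 size_f.
  have := size_polyMleq (p %% f) (q %% f).
  rewrite HE size_mul // size_f; have := small p; have := small q; lia.
have HC := size1_polyC sizeH.
pose x i := (p %% f)`_i; pose y i := (q %% f)`_i.
have x2 : x 2%N = 0 by rewrite /x nth_default.
have y2 : y 2%N = 0 by rewrite /y nth_default.
have cE i : H`_0 * f`_i = \sum_(j < i.+1) x j * y (i - j)%N.
  by rewrite -coefM HE {2}HC coefCM.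
have E0 := cE 0%N; have E1 := cE 1%N; have E2 := cE 2%N.
move: E0 E1 E2; rewrite !big_ord_recl !big_ord0 /= !subn0 x2 y2.
rewrite /bump /= !add1n => E0 E1 E2.
case/eqP: H0; rewrite HC; congr _%:P.
(* The discriminant of a product of two linear polynomials is the square of their resultant
   [x_0 y_1 - x_1 y_0]. *)
apply: (@disc_f_nonsquare (x 0%N * y 1%N - x 1%N * y 0%N)).
transitivity ((H`_0 * f`_1) ^+ 2 - 4%:R * (H`_0 * f`_2) * (H`_0 * f`_0)); last by ring.
by rewrite E0 E1 E2 !subSS !subn0; ring.
Qed.
End QuadraticPrime.

(** Setting the inner variable to 0 makes the product [h * f] vanish in a domain. As [f] survives,
    [h] vanishes there, so ['X] divides every coefficient of [h]. *)
Lemma scaleX_regular (A : idomainType) (f p h : {poly {poly A}}) :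
  map_poly (horner_eval 0) f != 0 -> 'X *: p = h * f ->
  exists h', p = h' * f.
Proof.
move=> f0 pE; pose ev := map_poly (horner_eval (0 : A)).
have h0 : ev h = 0.
  apply/eqP; have : ev h * ev f = 0.
    by rewrite -rmorphM -pE -mul_polyC rmorphM /= map_polyC /= /horner_eval hornerX mul0r.
  by move/eqP; rewrite mulf_eq0 (negPf f0) orbF.
have hE : h = 'X *: map_poly (drop_poly 1) h.
  apply/polyP => i; rewrite coefZ coef_map /=.
  have : (ev h)`_i = 0 by rewrite h0 coef0.
  rewrite coef_map /= /horner_eval horner_coef0 => hi0.
  rewrite -{1}(poly_take_drop 1 h`_i) mulrC expr1.
  rewrite [take_poly _ _]size1_polyC ?size_take_poly //.
  by rewrite coef_take_poly /= hi0 add0r.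
exists (map_poly (drop_poly 1) h).
have X0 : ('X : {poly A})%:P != 0 by rewrite polyC_eq0 polyX_eq0.
by apply: (mulfI X0); rewrite mul_polyC pE {1}hE mulrA mul_polyC.
Qed.

Lemma surface_formE (A : comNzRingType) (b c u v w : A) :
  surface_form b c u v w =
  w ^+ 3 * v ^+ 2 + (3%:R * u * w - 1) * v + cubic_form b c u.
Proof. by rewrite /surface_form /cubic_form; ring. Qed.

Lemma discriminantE (A : comNzRingType) (g u w : A) :
  (3%:R * u * w - 1) ^+ 2 - 4%:R * w ^+ 3 * g =
  - (4%:R * g) * w ^+ 3 + 9%:R * u ^+ 2 * w ^+ 2 - 6%:R * u * w + 1.
Proof. by ring. Qed.

(* [u] is the innermost variable, [w] the middle one and [v] the outermost. *)
Section SurfacePrime.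
Variables (k : fieldType) (b c : k).
Hypothesis char_not2 : 2%:R != 0 :> k.

Let A : idomainType := {poly {poly k}}.
Let cst (x : k) : A := x%:P%:P.
Let u : A := 'X%:P.
Let w : A := 'X.
Let f : {poly A} := surface_form (cst b)%:P (cst c)%:P u%:P 'X w%:P.

Let fE : f = (w ^+ 3)%:P * 'X^2 + (3%:R * u * w - 1)%:P * 'X
             + (cubic_form (cst b) (cst c) u)%:P.
Proof.
rewrite /f surface_formE rmorph_cubic_form.
by rewrite !(polyCM, polyCB, rmorphXn, rmorph_nat) /= polyC1.
Qed.

Let f0 : f`_0 = cubic_form (cst b) (cst c) u.
Proof. by rewrite fE !coefE /= !mulr0 !add0r. Qed.
Let f1 : f`_1 = 3%:R * u * w - 1.
Proof. by rewrite fE !coefE /= mulr0 mulr1 add0r addr0. Qed.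
Let f2 : f`_2 = w ^+ 3.
Proof. by rewrite fE !coefE /= mulr0 mulr1 !addr0. Qed.
Let size_f : size f = 3%N.
Proof.
apply/eqP; rewrite eqn_leq; apply/andP; split.
  apply/leq_sizeP => [[|[|[|j]]]] // _.
  by rewrite fE !coefE /= !mulr0 !addr0.
rewrite ltnNge; apply/negP => /leq_sizeP/(_ 2%N isT)/eqP.
by rewrite f2 expf_eq0 polyX_eq0.
Qed.

Let cubic_u_neq0 : cubic_form b%:P c%:P ('X : {poly k}) != 0.
Proof.
apply/eqP => /(congr1 (fun p : {poly k} => p`_3)); rewrite /cubic_form !coefE /=.
by rewrite mulr0 !subr0 => /eqP; rewrite oner_eq0.
Qed.

Let f_at0 : map_poly (horner_eval 0) f != 0.
Proof.
apply/eqP => /(congr1 (fun p : {poly {poly k}} => p`_0)); rewrite coef0 coef_map /=.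
rewrite f0 -rmorph_cubic_form /= /horner_eval hornerC.
by apply/eqP.
Qed.

Let disc_f x y : x ^+ 2 = (f`_1 ^+ 2 - 4%:R * f`_2 * f`_0) * y ^+ 2 -> y = 0.
Proof.
rewrite f0 f1 f2 -rmorph_cubic_form /=; set g := cubic_form _ _ _ => xE.
pose U : {poly k} := 'X.
have DE : (3%:R * u * w - 1) ^+ 2 - 4%:R * w ^+ 3 * g%:P =
  (- (4%:R * g))%:P * 'X^3 + (9%:R * U ^+ 2)%:P * 'X^2 - (6%:R * U)%:P * 'X + 1%:P.
  by rewrite discriminantE !(polyCN, polyCM, rmorphXn, rmorph_nat) /= polyC1.
have sizeD : size ((3%:R * u * w - 1) ^+ 2 - 4%:R * w ^+ 3 * g%:P) = 4%N.
  rewrite DE; apply/eqP; rewrite eqn_leq; apply/andP; split.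
    apply/leq_sizeP => [[|[|[|[|j]]]]] // _.
    by rewrite !coefE /= !mulr0 !addr0 subr0.
  rewrite ltnNge; apply/negP => /leq_sizeP/(_ 3%N isT)/eqP; rewrite !coefE /=.
  rewrite !mulr0 mulr1 subr0 !addr0 oppr_eq0 mulf_eq0 (negPf cubic_u_neq0) orbF.
  have -> : (4%:R : {poly k}) = (2%:R * 2%:R)%:P by rewrite -natrM rmorph_nat.
  by rewrite polyC_eq0 mulf_eq0 (negPf char_not2).
apply/eqP; apply: contraT => y0.
have D0 : (3%:R * u * w - 1) ^+ 2 - 4%:R * w ^+ 3 * g%:P != 0.
  by rewrite -size_poly_eq0 sizeD.
have x0 : x != 0.
  by move: (mulf_neq0 D0 (expf_neq0 2 y0)); rewrite -xE expf_eq0.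
(* Parity: a nonzero square has odd size, whereas a polynomial of size 4 times a nonzero square has
   even size. *)
have := congr1 (fun p : A => size p) xE.
rewrite [RHS]size_mul ?expf_neq0 // sizeD !expr2 !size_mul //.
move: x0 y0; rewrite -!size_poly_gt0; lia.
Qed.

Lemma nested_surface_form_prime p q h : p * q = h * f ->
  (exists h', p = h' * f) \/ (exists h', q = h' * f).
Proof.
apply: quadratic_prime => // {p q h} p h.
(* The leading coefficient is [w ^ 3], so [w] is cancelled three times. *)
rewrite f2 !exprS expr0 mulr1 -!scalerA.
move=> /(scaleX_regular f_at0)[h1 /(scaleX_regular f_at0)[h2]].
exact: scaleX_regular.
Qed.
End SurfacePrime.

(** * Passage to nested univariate polynomials *)

Section MpolyNested.
Variable k : fieldType.
Let P := {poly {poly {poly k}}}.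
Let cst : k -> P := polyC \o polyC \o polyC.

(** [u], [v], [w] become the innermost, outermost and middle indeterminates, which makes the
    equation a quadratic in the outermost one. *)
Definition to_nested : {rmorphism {mpoly k[3]} -> P} :=
  mmap cst (tnth [tuple 'X%:P%:P; 'X; 'X%:P : P]).

Definition of_nested : {rmorphism P -> {mpoly k[3]}} :=
  horner_eval (var 3 1) \o map_poly (horner_eval (var 3 2) \o map_poly
    (horner_eval (var 3 0) \o map_poly (@mpolyC 3 k))).

Let of_nested_cst x : of_nested (cst x) = x%:MP.
Proof. by do 3!rewrite /= horner_evalE map_polyC hornerC. Qed.

Let of_nested_v : of_nested 'X = var 3 1.
Proof. by rewrite /= horner_evalE map_polyX hornerX. Qed.

Let of_nested_w : of_nested 'X%:P = var 3 2.
Proof.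
by rewrite /= horner_evalE map_polyC hornerC /= horner_evalE map_polyX hornerX.
Qed.

Let of_nested_u : of_nested 'X%:P%:P = var 3 0.
Proof.
do 2!rewrite /= horner_evalE map_polyC hornerC.
by rewrite /= horner_evalE map_polyX hornerX.
Qed.

Let to_nestedX i : to_nested 'X_i = tnth [tuple 'X%:P%:P; 'X; 'X%:P : P] i.
Proof. by rewrite /= mmapX mmap1U. Qed.

Lemma of_nestedK x : of_nested (to_nested x) = x.
Proof.
rewrite [to_nested x]/(mmap _ _ x) /mmap rmorph_sum [RHS]mpolyE.
apply: eq_bigr => m _; rewrite rmorphM mpolyXE_id -mul_mpolyC of_nested_cst.
congr (_ * _); rewrite /mmap1 rmorph_prod; apply: eq_bigr => i _.
rewrite rmorphXn; congr (_ ^+ _).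
case: i => [[|[|[|//]]] lti]; rewrite (tnth_nth 0) [nth _ _ _]/=.
- by rewrite of_nested_u; congr 'X_(_); exact: val_inj.
- by rewrite of_nested_v; congr 'X_(_); exact: val_inj.
- by rewrite of_nested_w; congr 'X_(_); exact: val_inj.
Qed.

(** Divisibility by [f1] is carried to the nested ring by [to_nested] and brought back by
    [of_nested]. *)
Lemma X1_prime (b c : k) q r : 2%:R != 0 :> k ->
  in_ideal (X1 b c) (q * r) -> in_ideal (X1 b c) q \/ in_ideal (X1 b c) r.
Proof.
move=> char_not2 /in_ideal_seq1[a qrE].
have f1_nested : to_nested (f1 b c) =
    surface_form (cst b) (cst c) 'X%:P%:P 'X 'X%:P.
  by rewrite f1E rmorph_surface_form !to_nestedX /= !mmapC.
have := @nested_surface_form_prime k b c char_not2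
  (to_nested q) (to_nested r) (to_nested a).
rewrite -f1_nested -!rmorphM qrE => /(_ erefl)[] [h hE]; [left|right];
  apply/in_ideal_seq1; exists (of_nested h).
  by rewrite -[LHS]of_nestedK hE rmorphM of_nestedK.
by rewrite -[LHS]of_nestedK hE rmorphM of_nestedK.
Qed.

End MpolyNested.

(** * Rationality of the surface *)

Lemma in_ideal_meval (k : fieldType) n (S : seq {mpoly k[n]}) x q :
  in_ideal S q -> (forall p, p \in S -> p.@[x] = 0) -> q.@[x] = 0.
Proof.
move=> [a ->] Sx; rewrite rmorph_sum big1 // => i _.
by rewrite rmorphM /= [X in _ * X]Sx ?mulr0 //; apply: mem_nth.
Qed.

Lemma f1_meval (k : fieldType) (b c : k) (x : 'I_3 -> k) :
  (f1 b c).@[x] = surface_form b c (x (@Ordinal 3 0 isT)) (x (@Ordinal 3 1 isT))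
                    (x (@Ordinal 3 2 isT)).
Proof. by rewrite f1E rmorph_surface_form /= !mevalC !mevalXU. Qed.

(** Evaluation at one point of the surface shows both that the ideal is proper and that the open set
    is nonempty. At [s = z = 0] one has [g = - c] and [Q = - b], which are nonzero. *)
Lemma X1_rational (k : fieldType) (b c : k) :
  2%:R != 0 :> k -> b != 0 -> c != 0 -> rational_surface (X1 b c).
Proof.
move=> char_not2 b0 c0.
(* The point with chart coordinates s = z = 0. *)
pose x := tnth [tuple - (c / b); (c / b) ^+ 3; - (b / c)].
have X1x p : p \in X1 b c -> p.@[x] = 0.
  rewrite inE => /eqP->; rewrite f1_meval /x !(tnth_nth 0) /= /surface_form.
  by field; rewrite b0.
have open_x : (surface_open b c).@[x] != 0.
  rewrite rmorphM rmorph_homog_cubic /= !mevalC !mevalXU /x !(tnth_nth 0) /=.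
  (* This is [w ^ 4 g(z)] at [w = - b / c], [z = 0]. *)
  rewrite (_ : _ * _ = - c * (b / c) ^+ 4).
    by rewrite mulf_neq0 ?oppr_eq0 ?expf_neq0 ?mulf_neq0 ?invr_eq0.
  by rewrite /homog_cubic; field; rewrite b0 c0.
have open_0 : (plane_open b c).@[fun=> 0] != 0.
  rewrite rmorphM rmorph_cubic_form rmorph_conic_form /= !mevalC !mevalXU.
  rewrite /cubic_form /conic_form !expr0n !mulr0 !addr0 subr0 !sub0r.
  by rewrite mulf_neq0 ?oppr_eq0.
split; first split.
- by move=> /in_ideal_meval/(_ X1x)/eqP; rewrite rmorph1 oner_eq0.
- by move=> q r; apply: X1_prime.
- split=> [/in_ideal_nil/eqP|q r]; first by rewrite oner_eq0.
  move=> /in_ideal_nil/eqP; rewrite mulf_eq0 => /orP[] /eqP->; [left|right];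
  exact/in_ideal_nil.
exists (surface_open b c), (plane_open b c); split.
- by move=> /in_ideal_meval/(_ X1x)/eqP; rewrite (negPf open_x).
- by move=> /in_ideal_nil h0; rewrite h0 meval0 eqxx in open_0.
- exact: surface_isomorphic_plane.
Qed.

(** * Rational points *)

Section ConicCount.
Variable F : finFieldType.
Hypothesis no_cube_root1 : forall x : F, x ^+ 2 + x + 1 != 0.

Let N (P : F * F) := P.1 ^+ 2 + P.1 * P.2 + P.2 ^+ 2.

Let N_eq0 P : N P = 0 -> P = (0, 0).
Proof.
case: P => s z; rewrite /N /= => N0.
have z0 : z = 0.
  apply/eqP; apply: contraT => z0; case/negP: (no_cube_root1 (s / z)).
  rewrite (_ : _ + 1 = (s ^+ 2 + s * z + z ^+ 2) / z ^+ 2); last by field.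
  by rewrite N0 mul0r.
move: N0; rewrite z0 mulr0 addr0 expr0n addr0 => /eqP.
by rewrite expf_eq0 /= => /eqP ->.
Qed.

(* Multiplication of s - z * omega and s' - z' * omega, omega ^ 2 + omega + 1 = 0. *)
Let mul (P P' : F * F) :=
  (P.1 * P'.1 - P.2 * P'.2, P.1 * P'.2 + P.2 * P'.1 + P.2 * P'.2).

Let N_mul P P' : N (mul P P') = N P * N P'.
Proof. by rewrite /N /mul /=; ring. Qed.

Let mul_inj P : N P != 0 -> injective (mul P).
Proof.
move=> NP0 [s z] [s' z'] eqm.
have /N_eq0[/eqP s0 /eqP z0] : N (s - s', z - z') = 0.
  apply: (mulfI NP0); rewrite mulr0 -N_mul.
  rewrite (_ : mul _ _ = (0, 0)); first by rewrite /N /= mulr0 expr0n !addr0.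
  case: eqm => e1 e2; rewrite /mul /=; congr (_, _).
    rewrite (_ : _ - _ = P.1 * s - P.2 * z - (P.1 * s' - P.2 * z')); last by ring.
    by rewrite e1 subrr.
  rewrite (_ : _ + _ = P.1 * z + P.2 * s + P.2 * z
    - (P.1 * z' + P.2 * s' + P.2 * z')); last by ring.
  by rewrite e2 subrr.
by move: s0 z0; rewrite !subr_eq0 => /eqP-> /eqP->.
Qed.

Let fiber d := [set P | N P == d].

(* Project from the point (1, 0), sending that point to None; (1, -1) gets the
   slope -2 of the tangent line at (1, 0). *)
Let fiber1_le : (#|fiber 1%R| <= #|F|.+1)%N.
Proof.
pose slope P : option F :=
  if P.1 == 1 then if P.2 == 0 then None else Some (- 2%:R) else Some (P.2 / (P.1 - 1)).
rewrite -card_option -(@card_in_imset _ _ slope) ?max_card //.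
(* Substituting [z = t (s - 1)] in [N = 1] and dividing by [s - 1] leaves a linear equation in [s]
   with nonzero coefficient [t ^ 2 + t + 1], so the slope [t] determines the point. *)
have lineE s z : N (s, z) = 1 -> s != 1 ->
    s * ((z / (s - 1)) ^+ 2 + z / (s - 1) + 1) = (z / (s - 1)) ^+ 2 - 1.
  rewrite /N /= => N1 s1; have ds : s - 1 != 0 by rewrite subr_eq0.
  apply: (mulIf ds); apply/eqP; rewrite -subr_eq0.
  rewrite (_ : _ - _ = s ^+ 2 + s * z + z ^+ 2 - 1); last by field.
  by rewrite N1 subrr.
have vert z : N (1, z) = 1 -> z != 0 -> z = -1.
  rewrite /N /= => /eqP; rewrite -subr_eq0.
  rewrite (_ : _ - 1 = z * (z + 1)); last by ring.
  rewrite mulf_eq0 => /orP[->//|]; by rewrite addr_eq0 => /eqP.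
(* Slope -2 would give [3 s = 3], where [3 = (-2) ^ 2 - 2 + 1] is nonzero. *)
have tangent s z : N (s, z) = 1 -> s != 1 -> z / (s - 1) != - 2%:R.
  move=> N1 s1; apply/eqP => e; move: (lineE s z N1 s1); rewrite e.
  rewrite (_ : _ - 1 = 1 * ((- 2%:R) ^+ 2 + - 2%:R + 1)); last by ring.
  by move/(mulIf (no_cube_root1 _))/eqP; rewrite (negPf s1).
move=> [s z] [s' z']; rewrite !inE => /eqP N1 /eqP N1'; rewrite /slope /=.
have [s1|s1] := eqVneq s 1; have [s1'|s1'] := eqVneq s' 1.
- rewrite s1 s1' in N1 N1' *.
  have [->|z0] := eqVneq z 0; have [->|z0'] := eqVneq z' 0 => // _.
  by rewrite (vert z) // (vert z').
- by case: eqP => // _ [] /esym/eqP; rewrite (negPf (tangent _ _ N1' s1')).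
- by case: eqP => // _ [] /eqP; rewrite (negPf (tangent _ _ N1 s1)).
move=> [] e; have := lineE s z N1 s1; rewrite e -(lineE s' z' N1' s1').
move/(mulIf (no_cube_root1 _)) => es; rewrite es in e s1 *; congr (_, _).
by apply: (mulIf _ e); rewrite invr_eq0 subr_eq0.
Qed.

(** With [q = #|F|], each nonzero fiber embeds into the fiber of 1, hence has at most [q + 1]
    points, and the fiber of 0 is a single point. The total [q ^ 2 = 1 + (q - 1) (q + 1)] forces
    equality in every bound. *)
Lemma card_conic (d : F) : d != 0 ->
  #|[set P : F * F | P.1 ^+ 2 + P.1 * P.2 + P.2 ^+ 2 == d]| = #|F|.+1.
Proof.
have fiber_le e : e != 0 -> (#|fiber e| <= #|F|.+1)%N.
  move=> e0; have [->|[P]] := set_0Vmem (fiber e); first by rewrite cards0.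
  rewrite inE => /eqP NP.
  (* The inverse of [P]: its conjugate [(s + z, - z)] divided by its norm [e]. *)
  pose P' := ((P.1 + P.2) / e, - P.2 / e).
  have NP' : N P' = e^-1.
    rewrite -[RHS]mul1r -(mulfV e0) -{1}NP /N /P' /=; field; exact: e0.
  apply: leq_trans fiber1_le; rewrite -(card_imset _ (@mul_inj P' _)); last first.
    by rewrite NP' invr_eq0.
  apply/subset_leq_card/subsetP => _ /imsetP[R + ->]; rewrite !inE N_mul NP'.
  by move=> /eqP ->; rewrite mulVf.
have fiber0 : #|fiber 0| = 1%N.
  rewrite (_ : fiber 0 = [set (0, 0)]) ?cards1 //.
  apply/setP => P; rewrite !inE; apply/eqP/eqP => [/N_eq0|->] //.
  by rewrite /N /= mulr0 expr0n !addr0.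
have sum_fiber : (\sum_(e | e != 0%R) #|fiber e| = \sum_(e : F | e != 0%R) #|F|.+1)%N.
  rewrite sum_nat_const cardC1.
  have : (\sum_e #|fiber e| = #|F| * #|F|)%N.
    rewrite -card_prod -sum1_card (partition_big N predT) //=.
    apply: eq_bigr => e _; rewrite -sum1_card; apply: eq_bigl => P.
    by rewrite inE.
  rewrite (bigD1 0) //= fiber0.
  have : (0 < #|F|)%N by apply/card_gt0P; exists 0.
  by case: #|F| => // n _ /=; lia.
have := leqif_sum (fun e e0 => leqif_eq (fiber_le e e0)).
by move=> [_]; rewrite sum_fiber eqxx => /esym/forall_inP fE /fE/eqP.
Qed.
End ConicCount.

(** * Cube roots when the field order is 2 modulo 3 *)

Section CubicFree.
Variable F : finFieldType.
Hypothesis card_F : #|F| = 2 %[mod 3].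

(** The exponent inverts 3 modulo [q - 1], where [q = #|F|]: 3 divides [2 q - 1 = 2 (q - 1) + 1]. *)
Let cube_root (x : F) := x ^+ ((2 * #|F| - 1) %/ 3).

Lemma cube_rootK (x : F) : cube_root x ^+ 3 = x.
Proof.
rewrite /cube_root -exprM.
have -> : (((2 * #|F| - 1) %/ 3) * 3 = 2 * #|F| - 1)%N.
  by apply: divnK; move: card_F; set n := #|F|; lia.
have [->|x0] := eqVneq x 0; first by rewrite expr0n; case: eqP => //; move: card_F; lia.
apply: (mulIf x0); rewrite -exprSr.
have -> : ((2 * #|F| - 1).+1 = #|F| * 2)%N by move: card_F; set n := #|F|; lia.
by rewrite exprM expf_card expr2.
Qed.

(** A root satisfies [x ^ 3 = 1], so [x = x ^ #|F| = x ^ 2] and [x] is 0 or 1; the polynomial takes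
    the values 1 and 3 there. *)
Lemma no_primitive_cube_root (x : F) : 3%:R != 0 :> F -> x ^+ 2 + x + 1 != 0.
Proof.
move=> three0; apply/eqP => x0.
have x3 : x ^+ 3 = 1.
  apply/eqP; rewrite -subr_eq0 (_ : _ - 1 = (x - 1) * (x ^+ 2 + x + 1)).
    by rewrite x0 mulr0.
  by ring.
have x2 : x ^+ 2 = x.
  rewrite -[RHS](expf_card x) (divn_eq #|F| 3) card_F exprD mulnC exprM x3.
  by rewrite expr1n mul1r.
have /eqP : x * (x - 1) = 0 by rewrite mulrBr mulr1 -expr2 x2 subrr.
rewrite mulf_eq0 subr_eq0 => /orP[] /eqP x1; move/eqP: x0; rewrite x1.
  by rewrite expr0n !add0r oner_eq0.
by rewrite expr1n (_ : _ + 1 = 3%:R) ?(negPf three0) //; ring.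
Qed.
End CubicFree.

(** * Points of the surface *)

Section Count.
Variables (F : finFieldType) (b c : F).
Hypotheses (no_cube_root1 : forall x : F, x ^+ 2 + x + 1 != 0) (b0 : b != 0)
  (no_root : forall z, cubic_form b c z != 0).

Let point (u v w : F) : {ffun 'I_3 -> F} := [ffun i => tnth [tuple u; v; w] i].
Let X (x : {ffun 'I_3 -> F}) i : F := x (inord i).

Let pointE x : x = point (X x 0) (X x 1) (X x 2).
Proof.
apply/ffunP => -[[|[|[|//]]] lti]; rewrite ffunE (tnth_nth 0) /X /=;
by congr (x _); apply/val_inj; rewrite /= inordK.
Qed.

Let X_point u v w :
  (X (point u v w) 0 = u) * (X (point u v w) 1 = v) * (X (point u v w) 2 = w).
Proof. by rewrite /X !ffunE !(tnth_nth 0) !inordK. Qed.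

Let X1E x : (x \in rational_points (X1 b c)) =
  (surface_form b c (X x 0) (X x 1) (X x 2) == 0).
Proof.
rewrite inE /= andbT f1_meval /X.
by congr (surface_form _ _ (x _) (x _) (x _) == 0); apply/val_inj; rewrite /= inordK.
Qed.

Let card_w0 : #|[set x in rational_points (X1 b c) | X x 2 == 0]| = #|F|.
Proof.
pose f u := point u (cubic_form b c u) 0.
have injf : injective f by move=> u u' /(congr1 (fun x => X x 0)); rewrite !X_point.
rewrite -[RHS](card_imset _ injf); apply: eq_card => x; rewrite inE X1E.
apply/andP/imsetP => [[/eqP + /eqP w0]|[u _ ->]].
  rewrite /surface_form w0 => f0; exists (X x 0) => //; rewrite [LHS]pointE w0.
  congr (point _ _ _); apply/eqP; rewrite -subr_eq0 -oppr_eq0 -f0 /cubic_form.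
  by apply/eqP; ring.
by rewrite !X_point /surface_form /cubic_form; split => //; apply/eqP; ring.
Qed.

(** As [g] has no root, [w = - Q / g] is defined everywhere and is nonzero exactly off the conic, so
    the chart is bijective on all points with [w <> 0]. *)
Let card_w : #|[set x in rational_points (X1 b c) | X x 2 != 0]| =
  #|[set P : F * F | conic_form b P.1 P.2 != 0]|.
Proof.
pose m (P : F * F) := - (cubic_form b c P.2 / conic_form b P.1 P.2).
pose f P := point (P.2 + m P) (m P ^+ 2 * (P.1 - P.2 - m P)) (m P)^-1.
pose g x := (X x 0 + X x 1 * X x 2 ^+ 2, X x 0 - (X x 2)^-1).
have m0 P : conic_form b P.1 P.2 != 0 -> m P != 0.
  by move=> Q0; rewrite /m oppr_eq0 mulf_neq0 ?invr_eq0.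
have fK : {in [set P : F * F | conic_form b P.1 P.2 != 0], cancel f g}.
  move=> P; rewrite inE => /m0 mP0; rewrite /g !X_point [RHS]surjective_pairing.
  by move: (m P) mP0 => mP mP0; congr (_, _); [field | rewrite invrK addrK].
rewrite -(card_in_imset (can_in_inj fK)); apply: eq_card => x; rewrite inE X1E.
apply/andP/imsetP => [[/eqP f0 w0]|[P]].
  have gE : conic_form b (g x).1 (g x).2 = - X x 2 * cubic_form b c (g x).2.
    apply/eqP; rewrite -subr_eq0.
    have <- : X x 2 * surface_form b c (X x 0) (X x 1) (X x 2) =
       conic_form b (g x).1 (g x).2 - - X x 2 * cubic_form b c (g x).2.
      by rewrite /conic_form /surface_form /cubic_form /g /=; field.
    by rewrite f0 mulr0.
  exists (g x); first by rewrite inE gE mulf_neq0 ?oppr_eq0.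
  have mE : m (g x) = (X x 2)^-1.
    by rewrite /m gE; field; rewrite oppr_eq0 w0 no_root.
  rewrite [LHS]pointE /f mE invrK; congr (point _ _ _); rewrite /g /=; field; exact: w0.
rewrite inE => Q0 ->; rewrite !X_point invr_eq0 m0 //; split=> //.
have mE : m P * conic_form b P.1 P.2 = - cubic_form b c P.2.
  by rewrite /m mulNr divfK.
move: (m P) mE (m0 P Q0) => mP mE mP0; apply/eqP.
transitivity (mP * conic_form b P.1 P.2 + cubic_form b c P.2).
  by rewrite /surface_form /conic_form /cubic_form; field.
by rewrite mE addNr.
Qed.

Lemma card_X1 : #|rational_points (X1 b c)| = (#|F| ^ 2 - 1)%N.
Proof.
have cardD : (#|[set P : F * F | conic_form b P.1 P.2 != 0%R]| + #|F|.+1 = #|F| ^ 2)%N.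
  rewrite -(card_conic no_cube_root1 b0) addnC expnS expn1 -card_prod -cardsT.
  rewrite -(cardsID [set P : F * F | P.1 ^+ 2 + P.1 * P.2 + P.2 ^+ 2 == b] setT).
  congr (_ + _)%N; apply: eq_card => P; rewrite !inE //=.
  by rewrite andbT subr_eq0.
rewrite -(cardsID [set x | X x 2 == 0]) -setIdE card_w0.
rewrite (_ : _ :\: _ = [set x in rational_points (X1 b c) | X x 2 != 0]).
  by rewrite card_w; lia.
by apply/setP => x; rewrite !inE andbC.
Qed.
End Count.

(** * Conclusion over the prime field *)

Theorem theorem46 (p : nat) (b c : 'F_p)
    (p_prime : prime p) (p_mod6 : p = 5 %[mod 6])
    (g_irr : irreducible_poly ('X^3 - b *: 'X - c%:P : {poly 'F_p})) :
  rational_surface (X1 b c) /\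
  #|rational_points (X1 b c)| = (p ^ 2 - 1)%N.
Proof.
have no_root z : cubic_form b c z != 0.
  apply/negP => /eqP g0; case: g_irr => _ /(_ ('X - z%:P)).
  rewrite size_XsubC -root_factor_theorem rootE => /(_ isT).
  rewrite !hornerE -[_ - _ - _]/(cubic_form b c z) g0 eqxx => /(_ isT)/eqp_size.
  rewrite size_XsubC => sg.
  (* A root would make [g] an associate of a linear factor, against its leading coefficient 1 in
     degree 3. *)
  have : ('X^3 - b *: 'X - c%:P : {poly 'F_p})`_3 = 0.
    by rewrite nth_default // -sg.
  by rewrite !coefE /= mulr0 !subr0 => /eqP; rewrite oner_eq0.
have card_F : #|'F_p| = 2 %[mod 3] by rewrite card_Fp //; lia.
have small_neq0 n : (0 < n < 5)%N -> n%:R != 0 :> 'F_p.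
  move=> /andP[n0 n5]; rewrite -(dvdn_pcharf (pchar_Fp p_prime)).
  by apply/negP => /(dvdn_leq n0); move: p_prime; lia.
(* If [b = 0], the cube root of [c] is a root of [g]. *)
have b0 : b != 0.
  apply: contraNneq (no_root (c ^+ ((2 * #|'F_p| - 1) %/ 3))) => ->.
  by rewrite /cubic_form cube_rootK // mul0r subr0 subrr.
have c0 : c != 0.
  by move: (no_root 0); rewrite /cubic_form expr0n mulr0 subr0 sub0r oppr_eq0.
split; first exact: X1_rational (small_neq0 2%N isT) b0 c0.
rewrite card_X1 ?card_Fp // => x.
exact: no_primitive_cube_root (small_neq0 3%N isT).
Qed.
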